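(* Let $F:\mathbb{R}^n\to\mathbb{R}^m$ be continuous and $C:\mathbb{R}^n\rightrightarrows\mathbb{R}^m$ have closed graph. Define $\varSigma(u):=F(u)+C(u)$, $\mathcal{C}(u):=(-u,F(u))+\mathrm{gph}\,C$ (a map $\mathbb{R}^n\rightrightarrows\mathbb{R}^n\times\mathbb{R}^m$), $Q(u,y):=(F(u)+y)+\varDelta_{\mathrm{gph}\,C}(u,y)$ (a map $\mathbb{R}^n\times\mathbb{R}^m\rightrightarrows\mathbb{R}^m$), and $\mathcal{Q}(u,\sigma,y):=(-u+\sigma,F(u)+y)+\varDelta_{\mathrm{gph}\,C}(\sigma,y)$ (a map $\mathbb{R}^n\times\mathbb{R}^n\times\mathbb{R}^m\rightrightarrows\mathbb{R}^n\times\mathbb{R}^m$). Let $(\bar u,\bar y)\in\mathrm{gph}\,C$ and assume $F$ is strictly differentiable at $\bar u$. Then the numbers $R_\varSigma:=\mathrm{Reg}(\bar u,F(\bar u)+\bar y;\varSigma)$, $R_{\mathcal{C}}:=\mathrm{Reg}(\bar u,(0,F(\bar u)+\bar y);\mathcal{C})$, $R_Q:=\mathrm{Reg}((\bar u,\bar y),F(\bar u)+\bar y;Q)$, $R_{\mathcal{Q}}:=\mathrm{Reg}((\bar u,\bar u,\bar y),(0,F(\bar u)+\bar y);\mathcal{Q})$ are well defined and satisfy $R_\varSigma\ge\max\{R_{\mathcal{C}},R_Q\}\ge R_{\mathcal{Q}}\ge0$. Moreover, $R_{\mathcal{Q}}=0$ implies $R_\varSigma=R_{\mathcal{C}}=R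_Q=0$.
   Context: For a set $\Omega$, the indicator mapping is $\varDelta_\Omega(x):=\{0\}$ if $x\in\Omega$ and $\emptyset$ otherwise. The polar of a cone $K$ is $K^\circ:=\{v\mid v^\top w\le0\ \forall w\in K\}$; the tangent cone is $T_{C_0}(x):=\limsup_{\tau\searrow0}(C_0-x)/\tau$; the (limiting) normal cone is $N_{C_0}(\bar x):=\limsup_{x\to\bar x,\,x\in C_0}T_{C_0}(x)^\circ$ (Painlevé–Kuratowski outer limits), $N_{C_0}(\bar x):=\emptyset$ if $\bar x\notin C_0$. The coderivative of $S:\mathbb{R}^a\rightrightarrows\mathbb{R}^b$ at $(\bar x,\bar y)\in\mathrm{gph}\,S$ is $D^*S(\bar x|\bar y)(z):=\{v\mid(v,-z)\in N_{\mathrm{gph}\,S}(\bar x,\bar y)\}$. For $S$ with closed graph, $\mathrm{Reg}(u,y;S):=\inf_{\|z\|=1}\mathrm{dist}[0,D^*S(u|y)(z)]$ if $(u,y)\in\mathrm{gph}\,S$ and $:=\infty$ otherwise (with $\mathrm{dist}[0,\emptyset]=\infty$). *)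

(* Defs.v *)
(* R : realType, R^k represented as row vectors 'rV[R]_k,
   products R^a x R^b represented as 'rV[R]_(a + b) (row_mx / lsubmx / rsubmx),
   all with the Euclidean norm. Set-valued maps are functions into classical sets. *)
From HB Require Import structures.
From mathcomp Require Import all_boot all_order all_algebra.
From mathcomp Require Import all_classical all_reals ereal.
Set Implicit Arguments. Unset Strict Implicit. Unset Printing Implicit Defensive.
Import Order.TTheory GRing.Theory Num.Theory.
Local Open Scope classical_set_scope.
Local Open Scope ring_scope.

Section Defs.
Variable R : realType.

Definition dotv {k} (v w : 'rV[R]_k) : R := \sum_(i < k) v 0 i * w 0 i.
Definition enorm {k} (v : 'rV[R]_k) : R := Num.sqrt (dotv v v).

Definition eclosed {k} (A : set 'rV[R]_k) : Prop :=
  forall z, (forall e : R, 0 < e -> exists a, A a /\ enorm (a - z) < e) -> A z.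

Definition econtinuous {a b} (F : 'rV[R]_a -> 'rV[R]_b) : Prop :=
  forall x (e : R), 0 < e -> exists d : R, 0 < d /\
    forall x', enorm (x' - x) < d -> enorm (F x' - F x) < e.

Definition strictly_differentiable {a b} (F : 'rV[R]_a -> 'rV[R]_b)
  (ub : 'rV[R]_a) : Prop :=
  exists A : 'M[R]_(a, b), forall e : R, 0 < e -> exists d : R, 0 < d /\
    forall u u', enorm (u - ub) < d -> enorm (u' - ub) < d ->
      enorm (F u - F u' - (u - u') *m A) <= e * enorm (u - u').

Definition gph {a b} (S : 'rV[R]_a -> set 'rV[R]_b) : set 'rV[R]_(a + b) :=
  [set z | S (lsubmx z) (rsubmx z)].

Definition indicator {k l} (Om : set 'rV[R]_k) (x : 'rV[R]_k) : set 'rV[R]_l :=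
  [set v | Om x /\ v = 0].

Definition polar {k} (K : set 'rV[R]_k) : set 'rV[R]_k :=
  [set v | forall w, K w -> dotv v w <= 0].

(* tangent cone T_C(x) = limsup_{tau \searrow 0} (C - x)/tau
   (Painleve-Kuratowski outer limit): w belongs to it iff for all e, d > 0
   there are tau in (0, d) and w' in (C - x)/tau with |w' - w| < e. *)
Definition tangent_cone {k} (C : set 'rV[R]_k) (x : 'rV[R]_k) : set 'rV[R]_k :=
  [set w | forall e d : R, 0 < e -> 0 < d -> exists tau : R, exists w',
     [/\ 0 < tau, tau < d, C (x + tau *: w') & enorm (w' - w) < e]].

(* limiting normal cone N_C(xb) = limsup_{x -> xb, x in C} T_C(x)^o,
   and empty if xb is not in C *)
Definition normal_cone {k} (C : set 'rV[R]_k) (xb : 'rV[R]_k) : set 'rV[R]_k :=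
  [set v | C xb /\ forall e d : R, 0 < e -> 0 < d -> exists x, exists v',
     [/\ C x, enorm (x - xb) < d, polar (tangent_cone C x) v' &
         enorm (v' - v) < e]].

Definition coderivative {a b} (S : 'rV[R]_a -> set 'rV[R]_b)
  (xb : 'rV[R]_a) (yb : 'rV[R]_b) (z : 'rV[R]_b) : set 'rV[R]_a :=
  [set v | normal_cone (gph S) (row_mx xb yb) (row_mx v (- z))].

(* dist[0, A], = +oo when A is empty *)
Definition dist0 {k} (A : set 'rV[R]_k) : \bar R :=
  ereal_inf [set (enorm v)%:E | v in A].

Definition Reg {a b} (S : 'rV[R]_a -> set 'rV[R]_b)
  (u : 'rV[R]_a) (y : 'rV[R]_b) : \bar R :=
  if `[< S u y >] then
    ereal_inf [set dist0 (coderivative S u y z) | z in [set z | enorm z = 1]]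
  else +oo%E.

Section Maps.
Variables (n m : nat) (F : 'rV[R]_n -> 'rV[R]_m) (C : 'rV[R]_n -> set 'rV[R]_m).

Definition Sigma_map (u : 'rV[R]_n) : set 'rV[R]_m :=
  [set F u + c | c in C u].

Definition calC_map (u : 'rV[R]_n) : set 'rV[R]_(n + m) :=
  [set row_mx (- u) (F u) + p | p in gph C].

Definition Q_map (p : 'rV[R]_(n + m)) : set 'rV[R]_m :=
  [set F (lsubmx p) + rsubmx p + v | v in indicator (gph C) p].

Definition calQ_map (p : 'rV[R]_(n + (n + m))) : set 'rV[R]_(n + m) :=
  [set row_mx (- lsubmx p + lsubmx (rsubmx p)) (F (lsubmx p) + rsubmx (rsubmx p)) + v
  | v in indicator (gph C) (rsubmx p)].
End Maps.

End Defs.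

(* Main.v *)
Require Import Defs.
From HB Require Import structures.
From mathcomp Require Import all_boot all_order all_algebra.
From mathcomp Require Import all_classical all_reals ereal topology normedtype.
From mathcomp Require Import ring lra.
Import Order.TTheory GRing.Theory Num.Theory.
Import numFieldNormedType.Exports.
Local Open Scope classical_set_scope.
Local Open Scope ring_scope.

(* Let Phi map a closed set C into C', be strictly differentiable at x with
   matrix B, and have a continuous right inverse on C' taking Phi x to x.  Then
   v in N_C'(Phi x) implies v B^T in N_C(x).  Since Phi need not be
   differentiable near x, a regular normal v' of C' at a nearby point only gives
   that v' B^T is an approximate regular normal of C; projecting a small step in
   that direction back onto C produces a genuine normal close to it.
   Applied to four maps between the graphs of Sigma, calC, Q and calQ this
   carries coderivative elements of Sigma to those of calC and Q, of calC to
   those of calQ, and of calQ back to Sigma up to a perturbation controlled by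
   their norm.  If R_calQ = 0 this perturbation tends to 0, while the
   normalization forces the component z2 in R^m to stay away from 0, so
   rescaling gives R_Sigma = 0. *)

(** * Euclidean geometry of row vectors *)

Section Euclidean.
Set Implicit Arguments.
Unset Strict Implicit.
Context {R : realType}.

Lemma dotvC k (v w : 'rV[R]_k) : dotv v w = dotv w v.
Proof. by apply: eq_bigr => i _; rewrite mulrC. Qed.

Lemma dotvDl k (u v w : 'rV[R]_k) : dotv (u + v) w = dotv u w + dotv v w.
Proof. by rewrite -big_split; apply: eq_bigr => i _; rewrite !mxE mulrDl. Qed.

Lemma dotvZl k (t : R) (v w : 'rV[R]_k) : dotv (t *: v) w = t * dotv v w.
Proof. by rewrite mulr_sumr; apply: eq_bigr => i _; rewrite !mxE mulrA. Qed.

Lemma dotvNl k (v w : 'rV[R]_k) : dotv (- v) w = - dotv v w.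
Proof. by rewrite -scaleN1r dotvZl mulN1r. Qed.

Lemma dotvBl k (u v w : 'rV[R]_k) : dotv (u - v) w = dotv u w - dotv v w.
Proof. by rewrite dotvDl dotvNl. Qed.

Lemma dotvDr k (u v w : 'rV[R]_k) : dotv u (v + w) = dotv u v + dotv u w.
Proof. by rewrite !(dotvC u) dotvDl. Qed.

Lemma dotvBr k (u v w : 'rV[R]_k) : dotv u (v - w) = dotv u v - dotv u w.
Proof. by rewrite !(dotvC u) dotvBl. Qed.

Lemma dotvZr k (t : R) (v w : 'rV[R]_k) : dotv v (t *: w) = t * dotv v w.
Proof. by rewrite !(dotvC v) dotvZl. Qed.

Lemma dotv0l k (v : 'rV[R]_k) : dotv 0 v = 0.
Proof. by rewrite -(scale0r 0) dotvZl mul0r. Qed.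

Lemma dotv0r k (v : 'rV[R]_k) : dotv v 0 = 0.
Proof. by rewrite dotvC dotv0l. Qed.

Lemma dotvvB k (v w : 'rV[R]_k) :
  dotv (v - w) (v - w) = dotv v v - 2 * dotv v w + dotv w w.
Proof. by rewrite dotvBl !dotvBr (dotvC w v); ring. Qed.

Lemma dotvv_ge0 k (v : 'rV[R]_k) : 0 <= dotv v v.
Proof. by apply: sumr_ge0 => i _; rewrite -expr2 sqr_ge0. Qed.

Lemma enorm_ge0 k (v : 'rV[R]_k) : 0 <= enorm v.
Proof. exact: sqrtr_ge0. Qed.

Lemma enorm_sqr k (v : 'rV[R]_k) : enorm v ^+ 2 = dotv v v.
Proof. by rewrite sqr_sqrtr ?dotvv_ge0. Qed.

Lemma enorm_le k (v : 'rV[R]_k) (M : R) :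
  0 <= M -> (enorm v <= M) = (dotv v v <= M ^+ 2).
Proof. by move=> M0; rewrite -enorm_sqr ler_pXn2r ?nnegrE ?enorm_ge0. Qed.

Lemma enorm_lt k (v : 'rV[R]_k) (M : R) :
  0 <= M -> (enorm v < M) = (dotv v v < M ^+ 2).
Proof. by move=> M0; rewrite -enorm_sqr ltr_pXn2r ?nnegrE ?enorm_ge0. Qed.

Lemma enorm0 k : enorm (0 : 'rV[R]_k) = 0.
Proof. by rewrite /enorm dotv0l sqrtr0. Qed.

Lemma enormZ k (t : R) (v : 'rV[R]_k) : enorm (t *: v) = `|t| * enorm v.
Proof. by rewrite /enorm dotvZl dotvZr mulrA -expr2 sqrtrM ?sqr_ge0// sqrtr_sqr. Qed.

Lemma enormN k (v : 'rV[R]_k) : enorm (- v) = enorm v.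
Proof. by rewrite -scaleN1r enormZ normrN1 mul1r. Qed.

Lemma enormBC k (v w : 'rV[R]_k) : enorm (v - w) = enorm (w - v).
Proof. by rewrite -enormN opprB. Qed.

Lemma enorm_coord k (v : 'rV[R]_k) i : `|v 0 i| <= enorm v.
Proof.
rewrite -sqrtr_sqr ler_sqrt ?dotvv_ge0// /dotv (bigD1 i)//= -expr2 lerDl.
by apply: sumr_ge0 => j _; rewrite -expr2 sqr_ge0.
Qed.

Lemma enorm_eq0 k (v : 'rV[R]_k) : enorm v = 0 -> v = 0.
Proof.
move=> v0; apply/rowP => i; rewrite mxE; apply/normr0_eq0/le_anti.
by rewrite normr_ge0 -v0 enorm_coord.
Qed.

Lemma cauchy_schwarz k (v w : 'rV[R]_k) : dotv v w <= enorm v * enorm w.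
Proof.
have [/enorm_eq0 ->|v0] := eqVneq (enorm v) 0.
  by rewrite enorm0 mul0r dotv0l.
have [/enorm_eq0 ->|w0] := eqVneq (enorm w) 0.
  by rewrite enorm0 mulr0 dotv0r.
have {}v0 : 0 < enorm v by rewrite lt_neqAle eq_sym v0 enorm_ge0.
have {}w0 : 0 < enorm w by rewrite lt_neqAle eq_sym w0 enorm_ge0.
(* The square of this vector factors as [2 * (enorm v * enorm w)] times the gap in the
   inequality. *)
have := dotvv_ge0 (enorm w *: v - enorm v *: w).
rewrite dotvBl !dotvBr !dotvZl !dotvZr -!enorm_sqr (dotvC w v).
have -> : enorm w * (enorm w * enorm v ^+ 2) - enorm w * (enorm v * dotv v w) -
  (enorm v * (enorm w * dotv v w) - enorm v * (enorm v * enorm w ^+ 2)) =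
  (2 * (enorm v * enorm w)) * (enorm v * enorm w - dotv v w) by ring.
by rewrite pmulr_rge0 ?subr_ge0// !mulr_gt0.
Qed.

Lemma enormD k (v w : 'rV[R]_k) : enorm (v + w) <= enorm v + enorm w.
Proof.
rewrite enorm_le ?addr_ge0 ?enorm_ge0// dotvDl !dotvDr (dotvC w v) -!enorm_sqr.
by have := cauchy_schwarz v w; lra.
Qed.

Lemma enormB k (v w : 'rV[R]_k) : enorm (v - w) <= enorm v + enorm w.
Proof. by rewrite -(enormN w) enormD. Qed.

Lemma enorm_distD k (u v w : 'rV[R]_k) :
  enorm (u - w) <= enorm (u - v) + enorm (v - w).
Proof. by have := enormD (u - v) (v - w); rewrite subrKA. Qed.

Lemma enorm_small0 k (v : 'rV[R]_k) :
  (forall e : R, 0 < e -> enorm v < e) -> v = 0.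
Proof.
move=> h; apply: enorm_eq0; apply/le_anti; rewrite enorm_ge0 andbT leNgt.
by apply/negP => v0; have := h _ v0; rewrite ltxx.
Qed.

Lemma dotv_row a b (v v' : 'rV[R]_a) (w w' : 'rV[R]_b) :
  dotv (row_mx v w) (row_mx v' w') = dotv v v' + dotv w w'.
Proof.
rewrite /dotv big_split_ord /=.
by congr (_ + _); apply: eq_bigr => i _; rewrite ?row_mxEl ?row_mxEr.
Qed.

Lemma enorm_row_l a b (v : 'rV[R]_a) (w : 'rV[R]_b) : enorm v <= enorm (row_mx v w).
Proof. by rewrite ler_sqrt ?dotvv_ge0// dotv_row lerDl dotvv_ge0. Qed.

Lemma enorm_row_r a b (v : 'rV[R]_a) (w : 'rV[R]_b) : enorm w <= enorm (row_mx v w).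
Proof. by rewrite ler_sqrt ?dotvv_ge0// dotv_row lerDr dotvv_ge0. Qed.

Lemma enorm_row0 a b (v : 'rV[R]_a) : enorm (row_mx v (0 : 'rV[R]_b)) = enorm v.
Proof. by rewrite /enorm dotv_row dotv0l addr0. Qed.

Lemma enorm_0row a b (w : 'rV[R]_b) : enorm (row_mx (0 : 'rV[R]_a) w) = enorm w.
Proof. by rewrite /enorm dotv_row dotv0l add0r. Qed.

Lemma enorm_row_le a b (v : 'rV[R]_a) (w : 'rV[R]_b) :
  enorm (row_mx v w) <= enorm v + enorm w.
Proof.
rewrite -(enorm_row0 b v) -(enorm_0row a w).
by apply: le_trans (enormD _ _); rewrite add_row_mx addr0 add0r.
Qed.

Lemma dotv_mulmx_tr a b (B : 'M[R]_(a, b)) (x : 'rV[R]_a) (v : 'rV[R]_b) :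
  dotv (v *m B^T) x = dotv v (x *m B).
Proof.
have E k (p q : 'rV[R]_k) : dotv p q = (p *m q^T) 0 0.
  by rewrite mxE; apply: eq_bigr => i _; rewrite mxE.
by rewrite !E trmx_mul mulmxA.
Qed.

(** The constant is the Frobenius norm of [B]: Cauchy-Schwarz is applied to each column. *)
Lemma mulmx_bound a b (B : 'M[R]_(a, b)) :
  exists2 K : R, 0 <= K & forall v : 'rV[R]_a, enorm (v *m B) <= K * enorm v.
Proof.
pose c j : 'rV[R]_a := (col j B)^T.
exists (Num.sqrt (\sum_j dotv (c j) (c j))); first exact: sqrtr_ge0.
move=> v; have S0 : 0 <= \sum_j dotv (c j) (c j).
  by apply: sumr_ge0 => j _; exact: dotvv_ge0.
rewrite enorm_le ?mulr_ge0 ?sqrtr_ge0 ?enorm_ge0// exprMn sqr_sqrtr// mulr_suml.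
apply: ler_sum => j _; rewrite -expr2.
have Ec w : (w *m B) 0 j = dotv w (c j).
  by rewrite !mxE; apply: eq_bigr => i _; rewrite !mxE.
rewrite -real_normK ?num_real// -enorm_sqr mulrC -exprMn.
rewrite ler_pXn2r ?nnegrE ?mulr_ge0 ?enorm_ge0 ?normr_ge0//.
rewrite ler_norml Ec cauchy_schwarz andbT lerNl -dotvNl.
by rewrite -(enormN v) cauchy_schwarz.
Qed.

(** Compactness without extracting subsequences: the sets [P d], cut by the ball of radius [M],
    generate a proper filter on a compact box, and [w] is one of its cluster points. *)
Lemma bounded_cluster k (P : R -> set 'rV[R]_k) (M : R) :
  (forall d, 0 < d -> exists w, P d w /\ enorm w <= M) ->
  (forall d d', d <= d' -> P d `<=` P d') ->
  exists w, forall e d, 0 < e -> 0 < d -> exists w', P d w' /\ enorm (w' - w) < e.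
Proof.
move=> P0 Pmono.
pose Q d := P d `&` [set w | enorm w <= M].
pose G := filter_from [set d : R | 0 < d] Q.
have GF : ProperFilter G.
  apply: filter_from_proper; last by move=> d /P0[w [? ?]]; exists w.
  apply: filter_from_filter; first by exists 1 => /=.
  move=> d d' /= d0 d'0; exists (Num.min d d'); first by rewrite /= lt_min d0.
  move=> w [Pw wM]; split; split=> //; apply: Pmono Pw; rewrite ge_min lexx ?orbT//.
have cA : compact [set v : 'rV[R]_k | forall i, `[- M, M]%classic (v 0 i)].
  apply: (@rV_compact _ _ (fun=> `[- M, M]%classic)) => _.
  exact: segment_compact.
have [|w [_ clw]] := cA G GF.
  exists 1 => //= w [_ wM] i /=; rewrite in_itv /= -ler_norml.
  exact: le_trans (enorm_coord w i) wM.
exists w => e d e0 d0.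
have k0 : 0 < k.+1%:R :> R by rewrite ltr0n.
have [] := clw (Q d) [set w' | enorm (w' - w) < e].
- by exists d.
(* The ambient topology uses the maximum norm. Coordinates within [e / k.+1] give a squared
   Euclidean norm of at most [k * (e / k.+1)^2 < e^2]; the successor also covers [k = 0]. *)
- apply/nbhs_ballP; exists (e / k.+1%:R) => /=; first by rewrite divr_gt0.
  move=> w' ww' /=; rewrite enorm_lt ?ltW//.
  have lt1 i : ((w' - w) 0 i) * ((w' - w) 0 i) <= (e / k.+1%:R) ^+ 2.
    rewrite -expr2 -real_normK ?num_real// ler_pXn2r ?nnegrE ?normr_ge0 ?divr_ge0 ?ltW//.
    by have := ww'.2 0 i; rewrite /ball /= distrC !mxE.
  apply: le_lt_trans (ler_sum _ (fun i _ => lt1 i)) _.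
  rewrite sumr_const card_ord -[ltLHS]mulr_natr expr_div_n mulrAC ltr_pdivrMr ?exprn_gt0//.
  rewrite ltr_pM2l ?exprn_gt0// -natrX ltr_nat.
  by rewrite (leq_trans (ltnSn k))// expnS leq_pmulr.
- by move=> w' [[Pw' _] ?]; exists w'.
Qed.

End Euclidean.

(** * Normal cones *)

Section NormalCones.
Set Implicit Arguments.
Unset Strict Implicit.
Context {R : realType}.

(** If the estimate fails for [e], violating points arbitrarily close to [x] give unit directions
    [w'] with [e < dotv v w']. They cluster at a tangent direction [w], where polarity forces
    [dotv v w <= 0]. *)
Lemma polar_tangent_frechet k (C : set 'rV[R]_k) x v :
  polar (tangent_cone C x) v ->
  forall e : R, 0 < e -> exists2 d : R, 0 < d & forall x', C x' ->
    enorm (x' - x) < d -> dotv v (x' - x) <= e * enorm (x' - x).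
Proof.
move=> vT e e0; apply: contrapT => nd.
pose P (d : R) := [set w | [/\ enorm w = 1, e < dotv v w &
  exists tau, [/\ 0 < tau, tau < d & C (x + tau *: w)]]].
have [d d0||w clw] := @bounded_cluster _ k P 1.
- have [x' [Cx' x'd x'e]] : exists x', [/\ C x', enorm (x' - x) < d &
      e * enorm (x' - x) < dotv v (x' - x)].
    apply: contrapT => nx; apply: nd; exists d => // x' Cx' x'd.
    by rewrite leNgt; apply/negP => h; apply: nx; exists x'.
  have [/enorm_eq0 x'x|n0] := eqVneq (enorm (x' - x)) 0.
    by move: x'e; rewrite x'x enorm0 mulr0 dotv0r ltxx.
  have {}n0 : 0 < enorm (x' - x) by rewrite lt_neqAle eq_sym n0 enorm_ge0.
  exists ((enorm (x' - x))^-1 *: (x' - x)).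
  have n1 : enorm ((enorm (x' - x))^-1 *: (x' - x)) = 1.
    by rewrite enormZ ger0_norm ?invr_ge0 ?ltW// mulVf ?gt_eqF.
  split; last by rewrite n1.
  split=> //; first by rewrite dotvZr mulrC ltr_pdivlMr.
  exists (enorm (x' - x)); split=> //.
  by rewrite scalerA mulfV ?gt_eqF// scale1r addrC subrK.
- move=> d d' dd' w [w1 ew [tau [t0 td Ct]]]; split=> //; exists tau; split=> //.
  exact: lt_le_trans td dd'.
have : dotv v w <= 0.
  apply: vT => e' d e'0 d0; have [w' [[_ _ [tau [? ? ?]]] ?]] := clw _ _ e'0 d0.
  by exists tau, w'; split.
(* A direction within [e / (enorm v + 1)] of [w] changes the product with [v] by at most [e], so it
   cannot exceed [e]. Adding 1 covers [v = 0]. *)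
have v1 : 0 < enorm v + 1 by rewrite ltr_wpDl ?enorm_ge0.
have [w' [[_ ew _] w'w]] := clw _ 1 (divr_gt0 e0 v1) ltr01.
have : dotv v (w' - w) <= e.
  apply: le_trans (cauchy_schwarz _ _) _.
  apply: le_trans (ler_wpM2l (enorm_ge0 _) (ltW w'w)) _.
  rewrite mulrA ler_pdivrMr// mulrC ler_pM2l// lerDl ler01//.
by rewrite dotvBr; lra.
Qed.

(** Near-minimizers of the distance to [p] are bounded; a cluster point of them lies in the closed
    set [C] and attains the infimum. *)
Lemma projection_ex k (C : set 'rV[R]_k) (p x : 'rV[R]_k) :
  eclosed C -> C x -> exists2 c, C c & forall c', C c' -> enorm (c - p) <= enorm (c' - p).
Proof.
move=> Ccl Cx.
pose E := [set enorm (c - p) | c in C].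
have Einf : has_inf E.
  by split; [exists (enorm (x - p)), x|exists 0 => _ [c _ <-]; exact: enorm_ge0].
have lbE c : C c -> inf E <= enorm (c - p).
  by move=> Cc; apply: ge_inf; [case: Einf|exists c].
pose P (d : R) := [set c | C c /\ enorm (c - p) < inf E + d].
have [d d0||c clc] := @bounded_cluster _ k P (inf E + 1 + enorm p).
(* Capping the slack at 1 bounds the chosen near-minimizers independently of [d]. *)
- have m0 : 0 < Num.min d 1 by rewrite lt_min d0 ltr01.
  have [_ [c Cc <-] cd] := inf_adherent m0 Einf.
  have cd' : enorm (c - p) < inf E + d by rewrite (lt_le_trans cd)// lerD2l ge_min lexx.
  exists c; split=> //.
  rewrite -[c in leLHS](subrK p) (le_trans (enormD _ _))// lerD2r ltW//.
  by rewrite (lt_le_trans cd)// lerD2l ge_min lexx orbT.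
- by move=> d d' dd' c [Cc cd]; split=> //; rewrite (lt_le_trans cd)// lerD2l.
exists c.
  by apply: Ccl => e e0; have [c' [[? _] ?]] := clc _ 1 e0 ltr01; exists c'.
move=> c' Cc'; apply: le_trans (lbE _ Cc').
apply/ler_addgt0Pr => e e0; have e2 : 0 < e / 2 by rewrite divr_gt0.
have [c'' [[_ h1] h2]] := clc _ _ e2 e2.
have := enorm_distD c c'' p; rewrite (enormBC c c'').
lra.
Qed.

(** If [p - c] had a positive product [s] with a tangent direction, a short step from [c] within [C]
    would come closer to [p]: the gain is linear in the step length and the loss quadratic. *)
Lemma proximal_polar_tangent k (C : set 'rV[R]_k) (p c : 'rV[R]_k) :
  (forall c', C c' -> enorm (c - p) <= enorm (c' - p)) ->
  polar (tangent_cone C c) (p - c).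
Proof.
move=> cmin w Tw; rewrite leNgt; apply/negP => s0.
set s := dotv (p - c) w in s0; set q := enorm (p - c).
have q0 : 0 <= q := enorm_ge0 _.
have w0 : 0 <= enorm w := enorm_ge0 _.
(* The cap 1 gives [enorm w' <= enorm w + 1]; the other bound keeps [dotv (p - c) w'] above [s / 2].
   The bound on [tau] below then makes the quadratic term at most [s]. *)
pose e := Num.min 1 (s / (2 * (q + 1))).
have q1 : 0 < 2 * (q + 1) by lra.
have e0 : 0 < e by rewrite lt_min ltr01 divr_gt0.
have d0 : 0 < s / (enorm w + 1) ^+ 2 by rewrite divr_gt0// exprn_gt0//; lra.
have [tau [w' [t0 td Cw' w'w]]] := Tw _ _ e0 d0.
have qe : q * e < s / 2.
  have : q * e <= q * (s / (2 * (q + 1))) by rewrite ler_wpM2l// ge_min lexx orbT.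
  move=> /le_lt_trans; apply; rewrite mulrA ltr_pdivrMr//.
  by nra.
have sw' : s - q * e <= dotv (p - c) w'.
  have := cauchy_schwarz (p - c) (w - w'); rewrite dotvBr -/s -/q enormBC.
  have : q * enorm (w' - w) <= q * e by rewrite ler_wpM2l// ltW.
  lra.
have w'1 : enorm w' <= enorm w + 1.
  have : enorm (w' - w) < 1 by rewrite (lt_le_trans w'w)// ge_min lexx.
  by have := enormD (w' - w) w; rewrite subrK; lra.
have tw' : tau * enorm w' ^+ 2 <= s.
  apply: (@le_trans _ _ (tau * (enorm w + 1) ^+ 2)).
    by rewrite ler_pM2l// ler_pXn2r ?nnegrE ?enorm_ge0//; lra.
  by rewrite -ler_pdivlMr ?ltW// exprn_gt0//; lra.
have := cmin _ Cw'.
have -> : c + tau *: w' - p = tau *: w' - (p - c) by rewrite opprB addrA (addrC c).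
rewrite enormBC enorm_le ?enorm_ge0// enorm_sqr (dotvvB (tau *: w')) dotvZl !dotvZr dotvZl.
rewrite -!enorm_sqr (dotvC w') => h.
have : 2 * dotv (p - c) w' <= tau * enorm w' ^+ 2.
  by rewrite -(ler_pM2l t0); lra.
lra.
Qed.

(* The projection of x + t v onto C, for small t, is near x, and its proximal
   normal is near v. *)
Lemma approximate_normal k (C : set 'rV[R]_k) x v (e d : R) :
  eclosed C -> C x -> 0 < e -> 0 < d ->
  (forall x', C x' -> enorm (x' - x) < d -> dotv v (x' - x) <= e * enorm (x' - x)) ->
  exists x' v', [/\ C x', enorm (x' - x) < d, polar (tangent_cone C x') v' &
    enorm (v' - v) <= 2 * e].
Proof.
move=> Ccl Cx e0 d0 ve.
have n0 := enorm_ge0 v.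
have n1 : 0 < 2 * enorm v + 1 by lra.
have [t t0 td] : exists2 t, 0 < t & t * (2 * enorm v + 1) = d.
  by exists (d / (2 * enorm v + 1)); rewrite ?divr_gt0// divfK// gt_eqF.
have [c Cc cmin] := @projection_ex k C (x + t *: v) x Ccl Cx.
(* Comparing [c] with the competitor [x] gives this. Cauchy-Schwarz first places [c] within [d] of
   [x], so that the hypothesis on [v] applies to [c] and sharpens the bound to [2 * t * e]. *)
have r2 : enorm (c - x) ^+ 2 <= 2 * t * dotv v (c - x).
  have := cmin _ Cx; rewrite enorm_le ?enorm_ge0// enorm_sqr.
  have -> : c - (x + t *: v) = (c - x) - t *: v by rewrite opprD addrA.
  have -> : x - (x + t *: v) = - (t *: v) by rewrite opprD addrA subrr add0r.
  rewrite (dotvvB (c - x)) -!enorm_sqr enormN dotvZr (dotvC _ v); lra.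
have rs : enorm (c - x) <= 2 * t * enorm v.
  have [->|r0] := eqVneq (enorm (c - x)) 0; first by have := mulr_ge0 (ltW t0) n0; lra.
  have {}r0 : 0 < enorm (c - x) by rewrite lt_neqAle eq_sym r0 enorm_ge0.
  rewrite -(ler_pM2r r0) -expr2 (le_trans r2)// -[leRHS]mulrA ler_pM2l ?mulr_gt0//.
  exact: cauchy_schwarz.
have rd : enorm (c - x) < d by lra.
have re : enorm (c - x) <= 2 * t * e.
  have [->|r0] := eqVneq (enorm (c - x)) 0; first by have := mulr_ge0 (ltW t0) (ltW e0); lra.
  have {}r0 : 0 < enorm (c - x) by rewrite lt_neqAle eq_sym r0 enorm_ge0.
  rewrite -(ler_pM2r r0) -expr2 (le_trans r2)// -[leRHS]mulrA ler_pM2l ?mulr_gt0//.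
  exact: ve.
exists c, (t^-1 *: (x + t *: v - c)); split=> //.
- move=> w Tw; rewrite dotvZl pmulr_rle0 ?invr_gt0//.
  exact: (proximal_polar_tangent cmin).
- have -> : t^-1 *: (x + t *: v - c) - v = t^-1 *: (x - c).
    rewrite addrAC scalerDr scalerA mulVf ?gt_eqF// scale1r addrK//.
  rewrite enormZ gtr0_norm ?invr_gt0// mulrC ler_pdivrMr// enormBC.
  by rewrite mulrAC.
Qed.

Lemma normal_coneZ k (C : set 'rV[R]_k) x v (t : R) :
  0 < t -> normal_cone C x v -> normal_cone C x (t *: v).
Proof.
move=> t0 [Cx Nv]; split=> // e d e0 d0.
have [x' [v' [Cx' x'x pv' v'v]]] := Nv _ _ (divr_gt0 e0 t0) d0.
exists x', (t *: v'); split=> //.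
  by move=> w Tw; rewrite dotvZl pmulr_rle0//; exact: pv'.
by rewrite -scalerBr enormZ gtr0_norm// mulrC -ltr_pdivlMr.
Qed.

(** The derivative is named because its transpose carries normals; rows are multiplied on the right,
    so the adjoint sends [v] to [v *m A^T]. *)
Definition strict_derivative a b (F : 'rV[R]_a -> 'rV[R]_b) x (A : 'M[R]_(a, b)) :=
  forall e : R, 0 < e -> exists d : R, 0 < d /\
    forall u u', enorm (u - x) < d -> enorm (u' - x) < d ->
      enorm (F u - F u' - (u - u') *m A) <= e * enorm (u - u').

(** Continuity of [Psi] turns base points [y'] near [y] into base points [x' = Psi y'] near [x].
    Strictness, with both points free to move, lets the matrix [B] taken at [x] linearize [Phi]
    around every such [x']. *)
Lemma normal_cone_image a b (C : set 'rV[R]_a) (C' : set 'rV[R]_b)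
    (Phi : 'rV[R]_a -> 'rV[R]_b) (Psi : 'rV[R]_b -> 'rV[R]_a) x y (B : 'M[R]_(a, b)) v :
  eclosed C -> strict_derivative Phi x B -> econtinuous Psi -> Psi y = x ->
  (forall z, C z -> C' (Phi z)) ->
  (forall z, C' z -> C (Psi z) /\ Phi (Psi z) = z) ->
  normal_cone C' y v -> normal_cone C x (v *m B^T).
Proof.
move=> Ccl PhiB Psicont Psiy CC' C'C [C'y Nv]; split.
  by rewrite -Psiy; have [] := C'C _ C'y.
have := Psicont y; rewrite Psiy => {}Psicont e d e0 d0.
have [K K0 BTK] := mulmx_bound B^T; have [L L0 BL] := mulmx_bound B.
have M0 := enorm_ge0 v.
pose eta : R := e / (2 * (K + 1)).
pose e1 : R := Num.min 1 eta.
have eta0 : 0 < eta by rewrite divr_gt0//; lra.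
have e10 : 0 < e1 by rewrite lt_min ltr01.
(* [N] dominates [enorm v + 1], the factor of the linearization error, plus [L + 1], the Lipschitz
   factor in the normal inequality. With [N * e2 <= e / 8], [approximate_normal] costs [e / 4], and
   [eta] keeps the remaining error within [e / 2]. *)
pose N : R := enorm v + L + 3.
have N0 : 0 < N by rewrite /N; lra.
pose e2 := Num.min 1 (e / (8 * N)).
have e20 : 0 < e2 by rewrite lt_min ltr01 divr_gt0//; lra.
have e21 : e2 <= 1 by rewrite ge_min lexx.
have e2N : N * e2 <= e / 8.
  have : N * e2 <= N * (e / (8 * N)) by rewrite ler_pM2l// ge_min lexx orbT.
  have -> : N * (e / (8 * N)) = e / 8 by field; rewrite gt_eqF.
  by [].
have [d1 [d10 Phid]] := PhiB _ e20.
have dd0 : 0 < Num.min (d / 2) (d1 / 2) by rewrite lt_min !divr_gt0.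
have [d2 [d20 Psid]] := Psicont _ dd0.
have [y' [v' [C'y' y'y pv' v'v]]] := Nv _ _ e10 d20.
have x'x := Psid _ y'y; have [Cx' Px'] := C'C _ C'y'.
move: (Psi y') x'x Cx' Px' => x' x'x Cx' Px'.
have [x'd x'd1] : enorm (x' - x) < d / 2 /\ enorm (x' - x) < d1 / 2.
  by move: x'x; rewrite lt_min => /andP.
have [d3 d30 fre] := polar_tangent_frechet pv' e20.
(* In order: the new base point stays within [d] of [x]; the linearization holds at [z]; and [Phi z]
   is within [d3] of [y'], since [Phi] has Lipschitz constant [L + 1] there. *)
pose d4 := Num.min (d / 2) (Num.min (d1 / 2) (d3 / (L + 1))).
have d40 : 0 < d4 by rewrite !lt_min !divr_gt0//; lra.
have vN : enorm v' <= enorm v + 1.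
  have : enorm (v' - v) < 1 by rewrite (lt_le_trans v'v)// ge_min lexx.
  by have := enormD (v' - v) v; rewrite subrK; lra.
have [|x'' [v'' [Cx'' x''x' pv'' v''v']]] :=
    @approximate_normal _ C x' (v' *m B^T) (e / 8) d4 Ccl Cx' (divr_gt0 e0 (ltr0n _ 8)) d40.
  move=> z Cz; rewrite /d4 !lt_min => /and3P[_ zd1 zd3].
  have zd : enorm (z - x) < d1 by have := enorm_distD z x' x; lra.
  have x'd1' : enorm (x' - x) < d1 by lra.
  have lin := Phid _ _ zd x'd1'; rewrite Px' in lin.
  have z0 := enorm_ge0 (z - x').
  have PL : enorm (Phi z - y') <= (L + 1) * enorm (z - x').
    have := enormD (Phi z - y' - (z - x') *m B) ((z - x') *m B); rewrite subrK.
    have := BL (z - x'); nra.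
  have Pd3 : enorm (Phi z - y') < d3.
    by rewrite (le_lt_trans PL)// mulrC -ltr_pdivlMr//; lra.
  have h := fre _ (CC' _ Cz) Pd3.
  rewrite dotv_mulmx_tr.
  have h2 := cauchy_schwarz v' (- (Phi z - y' - (z - x') *m B)).
  rewrite enormN dotvC dotvNl dotvBl !(dotvC _ v') in h2.
  have h3 : enorm v' * enorm (Phi z - y' - (z - x') *m B) <=
      (enorm v + 1) * (e2 * enorm (z - x')).
    by rewrite ler_pM ?enorm_ge0.
  have h4 : e2 * enorm (Phi z - y') <= e2 * ((L + 1) * enorm (z - x')).
    by rewrite ler_pM2l.
  have h5 : N * e2 * enorm (z - x') <= e / 8 * enorm (z - x') by rewrite ler_wpM2r.
  have h6 : 0 <= e2 * enorm (z - x') by rewrite mulr_ge0// ltW.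
  rewrite /N in h5; nra.
exists x'', v''; split=> //.
  have := enorm_distD x'' x' x; move: x''x'; rewrite /d4 lt_min => /andP[? _]; lra.
have h1 := BTK (v' - v); rewrite mulmxBl in h1.
have := enorm_distD v'' (v' *m B^T) (v *m B^T).
have : K * enorm (v' - v) <= e / 2.
  apply: (@le_trans _ _ (K * eta)).
    by rewrite ler_wpM2l// (le_trans (ltW v'v))// ge_min lexx orbT.
  rewrite /eta mulrA ler_pdivrMr; lra.
lra.
Qed.

(** The set is the product of the whole space with [D]. All directions in the free factor are
    tangent, so polars vanish there, and tangents of [D] padded by zero are tangent to the
    product. *)
Lemma normal_cone_setT_prod a b (D : set 'rV[R]_b) (u v0 : 'rV[R]_a) (p v1 : 'rV[R]_b) :
  normal_cone [set z | D (rsubmx z)] (row_mx u p) (row_mx v0 v1) ->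
  v0 = 0 /\ normal_cone D p v1.
Proof.
case=> Dp Nv.
have Nv' e d : 0 < e -> 0 < d -> enorm v0 < e /\ exists x v', [/\ D x, enorm (x - p) < d,
    polar (tangent_cone D x) v' & enorm (v' - v1) < e].
  move=> e0 d0; have [z [v' []]] := Nv e d e0 d0.
  rewrite -(hsubmxK z) -(hsubmxK v'); move: (lsubmx z) (rsubmx z) (lsubmx v') (rsubmx v').
  move=> {z v'} z0 z1 w0 w1; rewrite /= row_mxKr => Dz1.
  rewrite !opp_row_mx !add_row_mx => hd pw hv.
  (* Polarity against the tangent direction [row_mx w0 0] gives [dotv w0 w0 <= 0]. *)
  have w00 : w0 = 0.
    apply: enorm_eq0; apply/eqP; rewrite -sqrf_eq0 enorm_sqr; apply/eqP/le_anti.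
    rewrite dotvv_ge0 andbT -[leLHS]addr0 -[X in _ + X](dotv0r w1) -dotv_row.
    apply: pw => e' d' e'0 d'0.
    exists (d' / 2), (row_mx w0 0); split; [lra|lra| |by rewrite subrr enorm0].
    by rewrite /= linearD linearZ/= !row_mxKr scaler0 addr0.
  split.
    rewrite -enormN -[- v0]add0r -w00.
    exact: le_lt_trans (enorm_row_l _ _) hv.
  exists z1, w1; split=> //.
  - exact: le_lt_trans (enorm_row_r _ _) hd.
  - move=> w Tw; rewrite -[leLHS]add0r -[X in X + _](dotv0r w0) -dotv_row.
    apply: pw => e' d' e'0 d'0.
    have [tau [w' [t0 td Dw' w'w]]] := Tw _ _ e'0 d'0.
    exists tau, (row_mx 0 w'); split=> //.
      by rewrite /= linearD linearZ/= !row_mxKr.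
    by rewrite opp_row_mx add_row_mx subr0 enorm_0row.
  - exact: le_lt_trans (enorm_row_r _ _) hv.
split.
  by apply: enorm_small0 => e e0; have [] := Nv' e 1 e0 ltr01.
split; first by move: Dp; rewrite /= row_mxKr.
by move=> e d e0 d0; have [] := Nv' e d e0 d0.
Qed.

End NormalCones.

(** * Strict derivatives and continuity *)

Section Calculus.
Set Implicit Arguments.
Unset Strict Implicit.
Context {R : realType}.

Lemma trmx_add a b (M N : 'M[R]_(a, b)) : (M + N)^T = M^T + N^T.
Proof. exact: linearD. Qed.

Lemma trmx_opp a b (M : 'M[R]_(a, b)) : (- M)^T = - M^T.
Proof. exact: linearN. Qed.

(** Projections are written as matrices so that their transposes, which act on normals, become
    padding by a zero block. *)
Definition lproj a b : 'M[R]_(a + b, a) := col_mx 1%:M 0.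
Definition rproj a b : 'M[R]_(a + b, b) := col_mx 0 1%:M.

Lemma lsubmxE a b (x : 'rV[R]_(a + b)) : lsubmx x = x *m lproj a b.
Proof. by rewrite -{2}(hsubmxK x) mul_row_col mulmx1 mulmx0 addr0. Qed.

Lemma rsubmxE a b (x : 'rV[R]_(a + b)) : rsubmx x = x *m rproj a b.
Proof. by rewrite -{2}(hsubmxK x) mul_row_col mulmx1 mulmx0 add0r. Qed.

Lemma mulmx_lprojT a b (v : 'rV[R]_a) : v *m (lproj a b)^T = row_mx v 0.
Proof. by rewrite tr_col_mx mul_mx_row trmx1 trmx0 mulmx1 mulmx0. Qed.

Lemma mulmx_rprojT a b (v : 'rV[R]_b) : v *m (rproj a b)^T = row_mx 0 v.
Proof. by rewrite tr_col_mx mul_mx_row trmx1 trmx0 mulmx1 mulmx0. Qed.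

Lemma strict_derivative_mulmx a b (B : 'M[R]_(a, b)) x :
  strict_derivative (fun u => u *m B) x B.
Proof.
move=> e e0; exists 1; split=> // u u' _ _.
by rewrite -mulmxBl subrr enorm0 mulr_ge0 ?enorm_ge0 ?ltW.
Qed.

Lemma strict_derivative_lsubmx a b (x : 'rV[R]_(a + b)) :
  strict_derivative (fun u => lsubmx u) x (lproj a b).
Proof.
rewrite (_ : (fun u => _) = (fun u => u *m lproj a b)).
  exact: strict_derivative_mulmx.
by apply/funext => u; rewrite lsubmxE.
Qed.

Lemma strict_derivative_rsubmx a b (x : 'rV[R]_(a + b)) :
  strict_derivative (fun u => rsubmx u) x (rproj a b).
Proof.
rewrite (_ : (fun u => _) = (fun u => u *m rproj a b)).
  exact: strict_derivative_mulmx.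
by apply/funext => u; rewrite rsubmxE.
Qed.

Lemma strict_derivativeN a b (F : 'rV[R]_a -> 'rV[R]_b) x A :
  strict_derivative F x A -> strict_derivative (fun u => - F u) x (- A).
Proof.
move=> FA e /FA[d [d0 Fd]]; exists d; split=> // u u' ud u'd.
by rewrite mulmxN -!opprD enormN Fd.
Qed.

Lemma strict_derivativeD a b (F G : 'rV[R]_a -> 'rV[R]_b) x A B :
  strict_derivative F x A -> strict_derivative G x B ->
  strict_derivative (fun u => F u + G u) x (A + B).
Proof.
move=> FA GB e e0; have e2 : 0 < e / 2 by rewrite divr_gt0.
have [d [d0 Fd]] := FA _ e2; have [d' [d'0 Gd]] := GB _ e2.
exists (Num.min d d'); split; first by rewrite lt_min d0.
move=> u u'; rewrite !lt_min => /andP[ud ud'] /andP[u'd u'd'].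
rewrite mulmxDr (opprD (F u')) (addrACA (F u)) (opprD (_ *m A)) (addrACA (F u - F u')).
rewrite (le_trans (enormD _ _))//.
by have := Fd _ _ ud u'd; have := Gd _ _ ud' u'd'; lra.
Qed.

Lemma strict_derivative_row a b c (F : 'rV[R]_a -> 'rV[R]_b)
    (G : 'rV[R]_a -> 'rV[R]_c) x A B :
  strict_derivative F x A -> strict_derivative G x B ->
  strict_derivative (fun u => row_mx (F u) (G u)) x (row_mx A B).
Proof.
move=> FA GB e e0; have e2 : 0 < e / 2 by rewrite divr_gt0.
have [d [d0 Fd]] := FA _ e2; have [d' [d'0 Gd]] := GB _ e2.
exists (Num.min d d'); split; first by rewrite lt_min d0.
move=> u u'; rewrite !lt_min => /andP[ud ud'] /andP[u'd u'd'].
rewrite mul_mx_row !opp_row_mx !add_row_mx (le_trans (enorm_row_le _ _))//.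
by have := Fd _ _ ud u'd; have := Gd _ _ ud' u'd'; lra.
Qed.

Lemma strict_derivative_comp a b c (F : 'rV[R]_a -> 'rV[R]_b)
    (G : 'rV[R]_b -> 'rV[R]_c) x A B :
  strict_derivative F x A -> strict_derivative G (F x) B ->
  strict_derivative (fun u => G (F u)) x (A *m B).
Proof.
move=> FA GB e e0.
have [K K0 AK] := mulmx_bound A; have [L L0 BL] := mulmx_bound B.
have K1 : 0 < 2 * (K + 1) by lra.
have L1 : 0 < 2 * (L + 1) by lra.
(* The error of [G] is multiplied by the local Lipschitz constant [K + 1] of [F], and that of [F] by
   [L]; each product is at most [e / 2]. Capping the error of [F] at 1 yields that Lipschitz
   constant. *)
have [d1 [d10 Gd]] := GB _ (divr_gt0 e0 K1).
have e20 : 0 < Num.min 1 (e / (2 * (L + 1))) by rewrite lt_min ltr01 divr_gt0.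
have [d2 [d20 Fd]] := FA _ e20.
have K1' : 0 < K + 1 by lra.
exists (Num.min d2 (d1 / (K + 1))); split; first by rewrite lt_min d20 divr_gt0.
have F1 u u' : enorm (u - x) < d2 -> enorm (u' - x) < d2 ->
    enorm (F u - F u') <= (K + 1) * enorm (u - u').
  move=> ud u'd; have := Fd _ _ ud u'd.
  have := enormD (F u - F u' - (u - u') *m A) ((u - u') *m A); rewrite subrK.
  have := AK (u - u').
  have : Num.min 1 (e / (2 * (L + 1))) * enorm (u - u') <= enorm (u - u').
    by rewrite ler_piMl ?enorm_ge0// ge_min lexx.
  lra.
have Fx u : enorm (u - x) < d2 -> enorm (u - x) < d1 / (K + 1) -> enorm (F u - F x) < d1.
  move=> ud ud1; rewrite (le_lt_trans (F1 _ _ ud _)) ?subrr ?enorm0//.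
  by rewrite mulrC -ltr_pdivlMr.
move=> u u'; rewrite !lt_min => /andP[ud ud'] /andP[u'd u'd'].
have h1 := Gd _ _ (Fx _ ud ud') (Fx _ u'd u'd').
have h2 := BL (F u - F u' - (u - u') *m A).
have h3 := enormD (G (F u) - G (F u') - (F u - F u') *m B) ((F u - F u' - (u - u') *m A) *m B).
rewrite (mulmxBl (F u - F u')) addrA subrK -mulmxA in h3.
have h4 : e / (2 * (K + 1)) * enorm (F u - F u') <= e / 2 * enorm (u - u').
  have /(ler_wpM2l (ltW (divr_gt0 e0 K1))) := F1 _ _ ud u'd.
  have -> : e / (2 * (K + 1)) * ((K + 1) * enorm (u - u')) = e / 2 * enorm (u - u').
    by field; rewrite !gt_eqF.
  by [].
have h5 : L * enorm (F u - F u' - (u - u') *m A) <= e / 2 * enorm (u - u').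
  have e2e : Num.min 1 (e / (2 * (L + 1))) <= e / (2 * (L + 1)) by rewrite ge_min lexx orbT.
  have /(ler_wpM2l L0)/le_trans := Fd _ _ ud u'd; apply.
  rewrite mulrA ler_wpM2r ?enorm_ge0//.
  apply: le_trans (ler_wpM2l L0 e2e) _.
  by rewrite mulrA ler_pdivrMr//; nra.
rewrite (mulmxBl (F u - F u')) -mulmxA in h2; lra.
Qed.

(** * Continuous maps and closed sets *)

Lemma econtinuous_mulmx a b (B : 'M[R]_(a, b)) : econtinuous (fun x => x *m B).
Proof.
move=> x e e0; have [K K0 BK] := mulmx_bound B.
have K1 : 0 < K + 1 by lra.
exists (e / (K + 1)); split; first by rewrite divr_gt0.
move=> x' x'd; rewrite -mulmxBl (le_lt_trans (BK _))//.
rewrite ltr_pdivlMr// in x'd; have := enorm_ge0 (x' - x); nra.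
Qed.

Lemma econtinuous_cst a b (c : 'rV[R]_b) : econtinuous (fun _ : 'rV[R]_a => c).
Proof. by move=> x e e0; exists 1; split=> // x' _; rewrite subrr enorm0. Qed.

Lemma econtinuous_lsubmx a b : econtinuous (fun x : 'rV[R]_(a + b) => lsubmx x).
Proof.
rewrite (_ : (fun x => _) = (fun x => x *m lproj a b)); first exact: econtinuous_mulmx.
by apply/funext => u; rewrite lsubmxE.
Qed.

Lemma econtinuous_rsubmx a b : econtinuous (fun x : 'rV[R]_(a + b) => rsubmx x).
Proof.
rewrite (_ : (fun x => _) = (fun x => x *m rproj a b)); first exact: econtinuous_mulmx.
by apply/funext => u; rewrite rsubmxE.
Qed.

Lemma econtinuous_comp a b c (F : 'rV[R]_a -> 'rV[R]_b) (G : 'rV[R]_b -> 'rV[R]_c) :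
  econtinuous F -> econtinuous G -> econtinuous (fun x => G (F x)).
Proof.
move=> cF cG x e /(cG (F x))[d [d0 Gd]]; have [d' [d'0 Fd]] := cF x d d0.
by exists d'; split=> // x' /Fd/Gd.
Qed.

Lemma econtinuousN a b (F : 'rV[R]_a -> 'rV[R]_b) :
  econtinuous F -> econtinuous (fun x => - F x).
Proof.
move=> cF x e /(cF x)[d [d0 Fd]]; exists d; split=> // x' /Fd.
by rewrite -opprD enormN.
Qed.

Lemma econtinuousD a b (F G : 'rV[R]_a -> 'rV[R]_b) :
  econtinuous F -> econtinuous G -> econtinuous (fun x => F x + G x).
Proof.
move=> cF cG x e e0; have e2 : 0 < e / 2 by rewrite divr_gt0.
have [d [d0 Fd]] := cF x _ e2; have [d' [d'0 Gd]] := cG x _ e2.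
exists (Num.min d d'); split; first by rewrite lt_min d0.
move=> x'; rewrite lt_min => /andP[/Fd h1 /Gd h2].
by rewrite opprD addrACA (le_lt_trans (enormD _ _))//; lra.
Qed.

Lemma econtinuous_row a b c (F : 'rV[R]_a -> 'rV[R]_b) (G : 'rV[R]_a -> 'rV[R]_c) :
  econtinuous F -> econtinuous G -> econtinuous (fun x => row_mx (F x) (G x)).
Proof.
move=> cF cG x e e0; have e2 : 0 < e / 2 by rewrite divr_gt0.
have [d [d0 Fd]] := cF x _ e2; have [d' [d'0 Gd]] := cG x _ e2.
exists (Num.min d d'); split; first by rewrite lt_min d0.
move=> x'; rewrite lt_min => /andP[/Fd h1 /Gd h2].
by rewrite opp_row_mx add_row_mx (le_lt_trans (enorm_row_le _ _))//; lra.
Qed.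

Lemma eclosed_preimage a b (F : 'rV[R]_a -> 'rV[R]_b) (D : set 'rV[R]_b) :
  econtinuous F -> eclosed D -> eclosed [set x | D (F x)].
Proof.
move=> cF cD z hz; apply: cD => e /(cF z)[d [d0 Fd]].
by have [a' [Da /Fd ad]] := hz d d0; exists (F a').
Qed.

Lemma eclosed_eq a b (F G : 'rV[R]_a -> 'rV[R]_b) :
  econtinuous F -> econtinuous G -> eclosed [set x | F x = G x].
Proof.
move=> cF cG.
have -> : [set x | F x = G x] = [set x | [set 0] (F x - G x)].
  by apply/seteqP; split=> x /=; [move=> ->; rewrite subrr|exact: subr0_eq].
apply: (@eclosed_preimage _ _ (fun x => F x - G x)).
  exact: econtinuousD (econtinuousN cG).
move=> z hz; apply: enorm_small0 => e /hz[_ [-> ]].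
by rewrite sub0r enormN.
Qed.

Lemma eclosedI a (A B : set 'rV[R]_a) : eclosed A -> eclosed B -> eclosed (A `&` B).
Proof.
by move=> cA cB z hz; split; [apply: cA|apply: cB] => e /hz[x [[? ?] ?]]; exists x.
Qed.

End Calculus.

(** * Regularity moduli *)

Section Regularity.
Set Implicit Arguments.
Unset Strict Implicit.
Context {R : realType}.

Lemma Reg_le a b (S : 'rV[R]_a -> set 'rV[R]_b) u y z v :
  enorm z = 1 -> coderivative S u y z v -> (Reg S u y <= (enorm v)%:E)%E.
Proof.
(* A normal cone is empty off its set, so [Dv] puts the point on the graph and excludes the default
   value [+oo]. *)
move=> z1 Dv; rewrite /Reg asboolT; last first.
  by have [] := Dv; rewrite /gph /= row_mxKl row_mxKr.
apply: (@le_trans _ _ (dist0 (coderivative S u y z))).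
  by apply: ereal_inf_lbound; exists z.
by apply: ereal_inf_lbound; exists v.
Qed.

Lemma Reg_ge a b (S : 'rV[R]_a -> set 'rV[R]_b) u y (r : \bar R) :
  (forall z v, enorm z = 1 -> coderivative S u y z v -> (r <= (enorm v)%:E)%E) ->
  (r <= Reg S u y)%E.
Proof.
move=> h; rewrite /Reg; case: ifP => _; last exact: leey.
apply/ereal_infP => _ [z z1 <-]; apply/ereal_infP => _ [v Dv <-].
exact: h Dv.
Qed.

Lemma Reg_ge0 a b (S : 'rV[R]_a -> set 'rV[R]_b) u y : (0 <= Reg S u y)%E.
Proof. by apply: Reg_ge => z v _ _; rewrite lee_fin enorm_ge0. Qed.

Lemma Reg_lt a b (S : 'rV[R]_a -> set 'rV[R]_b) u y (r : R) :
  (Reg S u y < r%:E)%E ->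
  exists z v, [/\ enorm z = 1, coderivative S u y z v & enorm v < r].
Proof.
move=> h; apply: contrapT => nex; move: h; apply/negP; rewrite -leNgt.
apply: Reg_ge => z v z1 Dv; rewrite lee_fin leNgt; apply/negP => vr.
by apply: nex; exists z, v.
Qed.

(** Coderivatives are positively homogeneous, so any nonzero [z] can be normalized at the cost of
    scaling [v]. *)
Lemma Reg_le_scale a b (S : 'rV[R]_a -> set 'rV[R]_b) u y z v (t : R) :
  0 < t -> t * enorm z = 1 -> coderivative S u y z v ->
  (Reg S u y <= (t * enorm v)%:E)%E.
Proof.
move=> t0 tz Dv; rewrite -{1}(gtr0_norm t0) -enormZ.
apply: (@Reg_le _ _ _ _ _ (t *: z)); first by rewrite enormZ gtr0_norm.
by rewrite /coderivative /= -scalerN -scale_row_mx; exact: normal_coneZ.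
Qed.

End Regularity.

(** * The four maps *)

Section GeneralizedEquation.
Set Implicit Arguments.
Unset Strict Implicit.
Context {R : realType} {n m : nat}.
Context {F : 'rV[R]_n -> 'rV[R]_m} {C : 'rV[R]_n -> set 'rV[R]_m}.

(** The next four descriptions express the graphs by continuous preimages of [gph C] and equations,
    which yields closedness and the maps between the graphs. *)
Lemma gph_Sigma_map : gph (Sigma_map F C) =
  [set z | gph C (row_mx (lsubmx z) (rsubmx z - F (lsubmx z)))].
Proof.
apply/seteqP; split=> z; rewrite /gph /= ?row_mxKl ?row_mxKr.
  by move=> [c Cc <-]; rewrite addrC addKr ?row_mxKl ?row_mxKr.
by move=> Cz; exists (rsubmx z - F (lsubmx z)) => //; rewrite addrC subrK.
Qed.

Lemma gph_calC_map : gph (calC_map F C) =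
  [set z | gph C (row_mx (lsubmx z + lsubmx (rsubmx z)) (rsubmx (rsubmx z) - F (lsubmx z)))].
Proof.
apply/seteqP; split=> z; rewrite /gph /= ?row_mxKl ?row_mxKr.
  move=> [p Cp <-]; rewrite -(hsubmxK p) add_row_mx !row_mxKl !row_mxKr.
  by rewrite addNKr addrC addKr.
move=> Cz.
exists (row_mx (lsubmx z + lsubmx (rsubmx z)) (rsubmx (rsubmx z) - F (lsubmx z))).
  by rewrite /gph /= row_mxKl row_mxKr.
by rewrite add_row_mx addKr addrC subrK hsubmxK.
Qed.

Lemma gph_Q_map : gph (Q_map F C) = [set z | gph C (lsubmx z)] `&`
  [set z | rsubmx z = F (lsubmx (lsubmx z)) + rsubmx (lsubmx z)].
Proof.
apply/seteqP; split=> z; rewrite /gph /=.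
  by move=> [v [Cz ->] <-]; rewrite addr0.
by move=> [Cz ->]; exists 0; rewrite ?addr0.
Qed.

Lemma gph_calQ_map : gph (calQ_map F C) = [set z | gph C (rsubmx (lsubmx z))] `&`
  [set z | rsubmx z = row_mx (- lsubmx (lsubmx z) + lsubmx (rsubmx (lsubmx z)))
                        (F (lsubmx (lsubmx z)) + rsubmx (rsubmx (lsubmx z)))].
Proof.
apply/seteqP; split=> z; rewrite /gph /=.
  by move=> [v [Cz ->] <-]; rewrite addr0.
by move=> [Cz ->]; exists 0; rewrite ?addr0.
Qed.

(** * Closedness of the four graphs *)

Context (Fcont : econtinuous F) (Ccl : eclosed (gph C)).

Let cl a b := @econtinuous_lsubmx R a b.
Let cr a b := @econtinuous_rsubmx R a b.

Lemma eclosed_gph_Sigma_map : eclosed (gph (Sigma_map F C)).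
Proof.
rewrite gph_Sigma_map.
apply: (eclosed_preimage (F := fun z => row_mx (lsubmx z) (rsubmx z - F (lsubmx z)))) Ccl.
apply: econtinuous_row (@cl _ _) _.
exact: econtinuousD (@cr _ _) (econtinuousN (econtinuous_comp (@cl _ _) Fcont)).
Qed.

Lemma eclosed_gph_calC_map : eclosed (gph (calC_map F C)).
Proof.
rewrite gph_calC_map.
apply: (eclosed_preimage (F := fun z => row_mx (lsubmx z + lsubmx (rsubmx z))
  (rsubmx (rsubmx z) - F (lsubmx z)))) Ccl.
apply: econtinuous_row.
  exact: econtinuousD (@cl _ _) (econtinuous_comp (@cr _ _) (@cl _ _)).
exact: econtinuousD (econtinuous_comp (@cr _ _) (@cr _ _))
  (econtinuousN (econtinuous_comp (@cl _ _) Fcont)).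
Qed.

Lemma eclosed_gph_Q_map : eclosed (gph (Q_map F C)).
Proof.
rewrite gph_Q_map; apply: eclosedI; first exact: eclosed_preimage (@cl _ _) Ccl.
apply: (eclosed_eq (@cr _ _)).
exact: econtinuousD (econtinuous_comp (econtinuous_comp (@cl _ _) (@cl _ _)) Fcont)
  (econtinuous_comp (@cl _ _) (@cr _ _)).
Qed.

Lemma eclosed_gph_calQ_map : eclosed (gph (calQ_map F C)).
Proof.
rewrite gph_calQ_map; apply: eclosedI.
  exact: eclosed_preimage (econtinuous_comp (@cl _ _) (@cr _ _)) Ccl.
apply: (eclosed_eq (@cr _ _)).
have cll := econtinuous_comp (@cl (n + (n + m)) (n + m)) (@cl _ _).
have clr := econtinuous_comp (@cl (n + (n + m)) (n + m)) (@cr _ _).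
apply: econtinuous_row.
  exact: econtinuousD (econtinuousN cll) (econtinuous_comp clr (@cl _ _)).
exact: econtinuousD (econtinuous_comp cll Fcont) (econtinuous_comp clr (@cr _ _)).
Qed.

(** * Transport of normals between the graphs *)

Context {ub : 'rV[R]_n} {yb : 'rV[R]_m} {A : 'M[R]_(n, m)}.
Context (FA : strict_derivative F ub A).

Let sl a b := @strict_derivative_lsubmx R a b.
Let sr a b := @strict_derivative_rsubmx R a b.

(** [Phi] sends [((u, y), s)] to [(u, s)], and [Psi] recovers [y = s - F u]. As [Phi] is linear,
    normals are just padded by zero. *)
Lemma normal_Q_of_Sigma (v : 'rV[R]_n) (w : 'rV[R]_m) :
  normal_cone (gph (Sigma_map F C)) (row_mx ub (F ub + yb)) (row_mx v w) ->
  normal_cone (gph (Q_map F C)) (row_mx (row_mx ub yb) (F ub + yb))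
    (row_mx (row_mx v 0) w).
Proof.
pose Psi (z : 'rV[R]_(n + m)) :=
  row_mx (row_mx (lsubmx z) (rsubmx z - F (lsubmx z))) (rsubmx z).
have dPhi := strict_derivative_row
  (strict_derivative_comp (@sl _ _ (row_mx (row_mx ub yb) (F ub + yb))) (@sl _ _ _))
  (@sr _ _ _).
move=> /(normal_cone_image (Psi := Psi) eclosed_gph_Q_map dPhi).
rewrite tr_row_mx mul_row_col trmx_mul mulmxA !mulmx_lprojT mulmx_rprojT.
rewrite add_row_mx addr0 add0r; apply.
- exact: econtinuous_row (econtinuous_row (@cl _ _) (econtinuousD (@cr _ _)
    (econtinuousN (econtinuous_comp (@cl _ _) Fcont)))) (@cr _ _).
- by rewrite /Psi !row_mxKl row_mxKr addrC addKr.
- rewrite gph_Q_map gph_Sigma_map => z /= [Cz zE].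
  by rewrite row_mxKl row_mxKr zE addrC addKr hsubmxK.
- rewrite gph_Q_map gph_Sigma_map => z /= Cz.
  by rewrite /Psi !row_mxKl !row_mxKr hsubmxK; split=> //; split=> //; rewrite addrC subrK.
Qed.

(** [Phi] sends [(u, (a, b))] to [(u + a, b + F (u + a) - F u)], and [Psi] takes [a = 0]. In the [u]
    block the two derivatives of [F] cancel; in the [a] block one survives as [w *m A^T]. *)
Lemma normal_calC_of_Sigma (v : 'rV[R]_n) (w : 'rV[R]_m) :
  normal_cone (gph (Sigma_map F C)) (row_mx ub (F ub + yb)) (row_mx v w) ->
  normal_cone (gph (calC_map F C)) (row_mx ub (row_mx 0 (F ub + yb)))
    (row_mx v (row_mx (v + w *m A^T) w)).
Proof.
set x := row_mx ub (row_mx 0 (F ub + yb)).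
pose Psi (z : 'rV[R]_(n + m)) := row_mx (lsubmx z) (row_mx (0 : 'rV[R]_n) (rsubmx z)).
have d12 := strict_derivativeD (@sl _ _ x)
  (strict_derivative_comp (@sr _ _ x) (@sl _ _ _)).
have FA1 : strict_derivative F (lsubmx x + lsubmx (rsubmx x)) A.
  by rewrite /x row_mxKr !row_mxKl addr0.
have FA2 : strict_derivative F (lsubmx x) A by rewrite /x row_mxKl.
have dPhi := strict_derivative_row d12 (strict_derivativeD
  (strict_derivative_comp (@sr _ _ x) (@sr _ _ _))
  (strict_derivativeD (strict_derivative_comp d12 FA1)
     (strict_derivativeN (strict_derivative_comp (@sl _ _ x) FA2)))).
move=> /(normal_cone_image (Psi := Psi) eclosed_gph_calC_map dPhi).
rewrite !(tr_row_mx, mul_row_col, trmx_mul, trmx_add, trmx_opp, mulmxDr, mulmxN, mulmxA).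
rewrite !(mulmx_lprojT, mulmx_rprojT, add_row_mx, opp_row_mx, addr0, add0r, oppr0).
rewrite subrr addr0; apply.
- exact: econtinuous_row (@cl _ _) (econtinuous_row (@econtinuous_cst _ _ _ _) (@cr _ _)).
- by rewrite /Psi row_mxKl row_mxKr.
- rewrite gph_calC_map gph_Sigma_map => z /= Cz.
  by rewrite row_mxKl row_mxKr (addrC (F _)) addrA addrK.
- rewrite gph_calC_map gph_Sigma_map => z /= Cz.
  by rewrite /Psi !(row_mxKl, row_mxKr, addr0) subrr addr0 hsubmxK.
Qed.

(** [Phi] drops the pair [(sigma, y)]; [Psi] recovers it from [(u, (a, b))] as
    [(u + a, b - F u)]. *)
Lemma normal_calQ_of_calC (v : 'rV[R]_n) (w : 'rV[R]_(n + m)) :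
  normal_cone (gph (calC_map F C)) (row_mx ub (row_mx 0 (F ub + yb))) (row_mx v w) ->
  normal_cone (gph (calQ_map F C))
    (row_mx (row_mx ub (row_mx ub yb)) (row_mx 0 (F ub + yb)))
    (row_mx (row_mx v 0) w).
Proof.
pose Psi (z : 'rV[R]_(n + (n + m))) :=
  row_mx (row_mx (lsubmx z) (row_mx (lsubmx z + lsubmx (rsubmx z))
    (rsubmx (rsubmx z) - F (lsubmx z)))) (rsubmx z).
have dPhi := strict_derivative_row
  (strict_derivative_comp
    (@sl _ _ (row_mx (row_mx ub (row_mx ub yb)) (row_mx (0 : 'rV[R]_n) (F ub + yb)))) (@sl _ _ _))
  (@sr _ _ _).
move=> /(normal_cone_image (Psi := Psi) eclosed_gph_calQ_map dPhi).
rewrite tr_row_mx mul_row_col trmx_mul mulmxA !mulmx_lprojT mulmx_rprojT.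
rewrite add_row_mx addr0 add0r; apply.
- apply: econtinuous_row (@cr _ _); apply: econtinuous_row (@cl _ _) _.
  apply: econtinuous_row (econtinuousD (@cl _ _) (econtinuous_comp (@cr _ _) (@cl _ _))) _.
  exact: econtinuousD (econtinuous_comp (@cr _ _) (@cr _ _))
    (econtinuousN (econtinuous_comp (@cl _ _) Fcont)).
- by rewrite /Psi !(row_mxKl, row_mxKr) addr0 addrC addKr.
- rewrite gph_calQ_map gph_calC_map => z /= [Cz zE].
  by rewrite !(row_mxKl, row_mxKr) zE !(row_mxKl, row_mxKr) addNKr addrC addKr hsubmxK.
- rewrite gph_calQ_map gph_calC_map => z /= Cz.
  rewrite /Psi !(row_mxKl, row_mxKr) hsubmxK; split=> //; split=> //.
  by rewrite addKr addrC subrK hsubmxK.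
Qed.

(** [gph (calQ_map F C)] is parametrized by a free [h = u - sigma] and a point [(sigma, s)] of the
    graph of [Sigma_map], with [u = h + sigma] and [y = s - F sigma]. Normals vanish in the free
    factor, which gives the equation; the other factor gives the normal to that graph. *)
Lemma normal_Sigma_of_calQ (v0 v1 w1 : 'rV[R]_n) (v2 w2 : 'rV[R]_m) :
  normal_cone (gph (calQ_map F C))
    (row_mx (row_mx ub (row_mx ub yb)) (row_mx 0 (F ub + yb)))
    (row_mx (row_mx v0 (row_mx v1 v2)) (row_mx w1 w2)) ->
  v0 - w1 + w2 *m A^T = 0 /\
  normal_cone (gph (Sigma_map F C)) (row_mx ub (F ub + yb))
    (row_mx (v0 + v1 - v2 *m A^T) (v2 + w2)).
Proof.
pose x : 'rV[R]_(n + (n + m)) := row_mx 0 (row_mx ub (F ub + yb)).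
pose p (z : 'rV[R]_(n + (n + m) + (n + m))) := lsubmx (rsubmx (lsubmx z)).
pose Psi z := row_mx (lsubmx (lsubmx z) - p z)
  (row_mx (p z) (F (p z) + rsubmx (rsubmx (lsubmx z)))).
have dlr := strict_derivative_comp (@sr _ _ x) (@sl _ _ _).
have FA1 : strict_derivative F (lsubmx (rsubmx x)) A by rewrite /x row_mxKr row_mxKl.
have FA2 : strict_derivative F (lsubmx x + lsubmx (rsubmx x)) A.
  by rewrite /x row_mxKr !row_mxKl add0r.
have dy := strict_derivativeD (strict_derivative_comp (@sr _ _ x) (@sr _ _ _))
  (strict_derivativeN (strict_derivative_comp dlr FA1)).
have d12 := strict_derivativeD (@sl _ _ x) dlr.
have dPhi := strict_derivative_row
  (strict_derivative_row d12 (strict_derivative_row dlr dy))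
  (strict_derivative_row (strict_derivativeN (@sl _ _ x))
     (strict_derivativeD (strict_derivative_comp d12 FA2) dy)).
have cp : econtinuous p.
  have c1 := econtinuous_comp (econtinuous_comp (@cl (n + (n + m)) (n + m)) (@cr _ _)) (@cl _ _).
  exact: c1.
have Ocl := eclosed_preimage (@cr n _) eclosed_gph_Sigma_map.
move=> /(normal_cone_image (Psi := Psi) Ocl dPhi).
rewrite !(tr_row_mx, mul_row_col, trmx_mul, trmx_add, trmx_opp, mulmxDr, mulmxN, mulmxA).
rewrite !(mulmx_lprojT, mulmx_rprojT, add_row_mx, opp_row_mx, addr0, add0r, oppr0).
(* These are the blocks for [h], [sigma] and [s]; in the [sigma] block the two terms [w2 *m A^T]
   cancel. *)
set r := (X in normal_cone _ x X); have -> : r = row_mx (v0 - w1 + w2 *m A^T)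
    (row_mx (v0 + v1 - v2 *m A^T) (v2 + w2)).
  rewrite /r; move: (v2 *m A^T) (w2 *m A^T) => a b.
  by congr (row_mx _ (row_mx _ _)); apply/rowP => i; rewrite !mxE; ring.
move=> H; apply: normal_cone_setT_prod; rewrite -/x; apply: H.
- apply: econtinuous_row.
    exact: econtinuousD (econtinuous_comp (@cl _ _) (@cl _ _)) (econtinuousN cp).
  apply: econtinuous_row cp (econtinuousD (econtinuous_comp cp Fcont) _).
  exact: econtinuous_comp (econtinuous_comp (@cl _ _) (@cr _ _)) (@cr _ _).
- by rewrite /Psi /p !(row_mxKl, row_mxKr) subrr.
- rewrite gph_calQ_map gph_Sigma_map => z /= Cz.
  rewrite !(row_mxKl, row_mxKr); split=> //.
  by congr row_mx; rewrite opprD subrK.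
- rewrite gph_calQ_map gph_Sigma_map /Psi /p => z /= [Cz zE].
  rewrite !(row_mxKl, row_mxKr) subrK addrAC subrr add0r hsubmxK; split=> //.
  by rewrite hsubmxK opprB addrC -zE hsubmxK.
Qed.


(** * Comparison of the four moduli *)

Let RSigma := Reg (Sigma_map F C) ub (F ub + yb).
Let RcalC := Reg (calC_map F C) ub (row_mx 0 (F ub + yb)).
Let RQ := Reg (Q_map F C) (row_mx ub yb) (F ub + yb).
Let RcalQ := Reg (calQ_map F C) (row_mx ub (row_mx ub yb)) (row_mx 0 (F ub + yb)).

(** The transported element keeps [v], while its argument [zeta] contains [z] as a block and so has
    norm at least 1; normalizing [zeta] can only shrink [v]. *)
Lemma Reg_calC_le_Sigma : (RcalC <= RSigma)%E.
Proof.
apply: Reg_ge => z v z1 Dv.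
pose zeta := row_mx (z *m A^T - v) z.
have zeta1 : 1 <= enorm zeta by rewrite -z1 enorm_row_r.
have zeta0 : 0 < enorm zeta by rewrite (lt_le_trans ltr01).
have Dv' : coderivative (calC_map F C) ub (row_mx 0 (F ub + yb)) zeta v.
  have := normal_calC_of_Sigma Dv.
  by rewrite /coderivative /= opp_row_mx opprB mulNmx.
have := Reg_le_scale _ (mulVf (lt0r_neq0 zeta0)) Dv'; rewrite invr_gt0.
move=> /(_ zeta0)/le_trans; apply; rewrite lee_fin ler_piMl ?enorm_ge0//.
by rewrite invf_le1.
Qed.

Lemma Reg_Q_le_Sigma : (RQ <= RSigma)%E.
Proof.
apply: Reg_ge => z v z1 Dv; rewrite -(enorm_row0 m).
exact: Reg_le z1 (normal_Q_of_Sigma Dv).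
Qed.

Lemma Reg_calQ_le_calC : (RcalQ <= RcalC)%E.
Proof.
apply: Reg_ge => z v z1 Dv; rewrite -(enorm_row0 (n + m)).
exact: Reg_le z1 (normal_calQ_of_calC Dv).
Qed.

Lemma Reg_Sigma_eq0 : RcalQ = 0%E -> RSigma = 0%E.
Proof.
move=> RQ0; apply/le_anti; rewrite Reg_ge0 andbT.
apply/lee_addgt0Pr => e e0; rewrite add0e.
have [K K0 AK] := mulmx_bound A^T.
have K1 : 0 < K + 1 by lra.
(* [q] will bound [enorm (w2 - v2)] from below, using [eta <= q / 2]. The second bound on [eta]
   makes the perturbation, at most [(K + 2) * eta], no larger than [e * q], so that dividing by
   [enorm (w2 - v2)] leaves at most [e]. *)
pose q := (2 * (K + 1))^-1.
have q0 : 0 < q by rewrite invr_gt0; lra.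
have qK : q * (K + 1) = 1 / 2 by rewrite /q; field; rewrite gt_eqF.
pose eta := Num.min (q / 2) (e * q / (K + 2)).
have eta0 : 0 < eta by rewrite lt_min !divr_gt0 ?mulr_gt0//; lra.
have eta1 : eta <= q / 2 by rewrite ge_min lexx.
have eta2 : (K + 2) * eta <= e * q.
  by rewrite mulrC -ler_pdivlMr ?ge_min ?lexx ?orbT//; lra.
have [|z [v [z1 Dv ve]]] := @Reg_lt _ _ _ (calQ_map F C)
  (row_mx ub (row_mx ub yb)) (row_mx 0 (F ub + yb)) eta.
  by rewrite -/RcalQ RQ0 lte_fin.
move: z1 Dv ve; rewrite -(hsubmxK z) -(hsubmxK v) -(hsubmxK (rsubmx v)).
move: (lsubmx z) (rsubmx z) (lsubmx v) (lsubmx (rsubmx v)) (rsubmx (rsubmx v)).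
move=> {z v} w1 w2 v0 v1 v2 w_1 Dv ve.
move: Dv; rewrite /coderivative /= opp_row_mx => /normal_Sigma_of_calQ[].
rewrite opprK mulNmx => w1E NS.
have v0e : enorm v0 < eta := le_lt_trans (enorm_row_l _ _) ve.
have v12e : enorm (row_mx v1 v2) < eta := le_lt_trans (enorm_row_r _ _) ve.
have v1e : enorm v1 < eta := le_lt_trans (enorm_row_l _ _) v12e.
have v2e : enorm v2 < eta := le_lt_trans (enorm_row_r _ _) v12e.
(* The equation from the free factor determines [w1] by [w2] and the small [v0]; with [row_mx w1 w2]
   of norm 1, this keeps [w2] away from 0. *)
have w1le : enorm w1 <= K * enorm w2 + enorm v0.
  have -> : w1 = w2 *m A^T - v0.
    by rewrite -(subr0_eq w1E) addrC addKr.
  by rewrite (le_trans (enormB _ _))// lerD2r.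
have w2ge : 1 <= (K + 1) * enorm w2 + eta.
  by have := enorm_row_le w1 w2; rewrite w_1; lra.
have z2 : enorm w2 <= enorm (w2 - v2) + enorm v2.
  by have := enormD (w2 - v2) v2; rewrite subrK.
have zq : q <= enorm (w2 - v2).
  have : q <= q * ((K + 1) * enorm w2 + eta) by rewrite ler_pMr.
  rewrite mulrDr mulrA qK.
  have : q <= 1 / 2 by rewrite -qK ler_peMr//; lra.
  have := ltW eta0; nra.
have z0 : 0 < enorm (w2 - v2) by rewrite (lt_le_trans q0).
(* The coderivative carries a minus sign on its argument, so [NS] is an element of the coderivative
   of [Sigma_map] at [w2 - v2]. *)
rewrite -(opprB w2) in NS.
have := Reg_le_scale _ (mulVf (lt0r_neq0 z0)) NS; rewrite invr_gt0.
move=> /(_ z0)/le_trans; apply; rewrite lee_fin mulrC ler_pdivrMr//.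
have : enorm (v0 + v1 - v2 *m A^T) <= (K + 2) * eta.
  rewrite (le_trans (enormB _ _))//.
  have := enormD v0 v1; have := AK v2.
  have : K * enorm v2 <= K * eta by rewrite ler_wpM2l// ltW.
  lra.
move=> /le_trans; apply; rewrite (le_trans eta2)// ler_pM2l//.
Qed.

End GeneralizedEquation.

Theorem theorem5 (R : realType) (n m : nat)
  (F : 'rV[R]_n -> 'rV[R]_m) (C : 'rV[R]_n -> set 'rV[R]_m)
  (ub : 'rV[R]_n) (yb : 'rV[R]_m) :
  econtinuous F ->
  eclosed (gph C) ->
  gph C (row_mx ub yb) ->
  strictly_differentiable F ub ->
  let RSigma := Reg (Sigma_map F C) ub (F ub + yb) in
  let RcalC := Reg (calC_map F C) ub (row_mx 0 (F ub + yb)) in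
  let RQ := Reg (Q_map F C) (row_mx ub yb) (F ub + yb) in
  let RcalQ := Reg (calQ_map F C) (row_mx ub (row_mx ub yb)) (row_mx 0 (F ub + yb)) in
  [/\ eclosed (gph (Sigma_map F C)), eclosed (gph (calC_map F C)),
      eclosed (gph (Q_map F C)) & eclosed (gph (calQ_map F C))] /\
  [/\ (maxe RcalC RQ <= RSigma)%E, (RcalQ <= maxe RcalC RQ)%E, (0 <= RcalQ)%E &
      (RcalQ = 0%E -> [/\ RSigma = 0%E, RcalC = 0%E & RQ = 0%E])].
Proof.
move=> Fcont Ccl _ [A FA] RSigma RcalC RQ RcalQ; split; first split.
- exact: eclosed_gph_Sigma_map.
- exact: eclosed_gph_calC_map.
- exact: eclosed_gph_Q_map.
- exact: eclosed_gph_calQ_map.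
have RCS : (RcalC <= RSigma)%E := Reg_calC_le_Sigma Fcont Ccl FA.
have RQS : (RQ <= RSigma)%E := Reg_Q_le_Sigma Fcont Ccl.
split; [by rewrite ge_max RCS|by rewrite le_max Reg_calQ_le_calC|exact: Reg_ge0|].
move=> /(Reg_Sigma_eq0 Fcont Ccl FA) RS0.
by split=> //; apply/le_anti; rewrite Reg_ge0 andbT -RS0.
Qed.
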